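(* Let $n>1$ and let $L^{2n}$ be a hyper-Lagrangian submanifold of a hyperkähler $4n$-manifold $M$. Then $L$ is a complex Lagrangian submanifold of $M$.
   Context: Manifolds are smooth and connected. A hyperkähler $4n$-manifold is a Riemannian manifold $(M^{4n},\bar g)$ with parallel (with respect to the Levi-Civita connection) orthogonal almost complex structures $J_1,J_2$ with $J_1J_2=-J_2J_1$; set $J_3:=J_1J_2$, so $J_1^2=J_2^2=J_3^2=J_1J_2J_3=-1$. For $\lambda=(\lambda_1,\lambda_2,\lambda_3)\in\mathbb{S}^2\subset\mathbb{R}^3$ (possibly depending on the point) put $\hat J=\sum_{\alpha=1}^3\lambda_\alpha J_\alpha$. The associated symplectic $2$-form is $\Omega_{\hat J}=\omega_K+\sqrt{-1}\,\omega_{K\hat J}$, where $\omega_{K}=\bar g(K\cdot,\cdot)$ and $K=\sum_\alpha\mu_\alpha J_\alpha$, with $\mu\in\mathbb{S}^2$ and $\sum_\alpha\lambda_\alpha\mu_\alpha=0$. Vanishing of $\Omega_{\hat J}$ on a subspace does not depend on the choice of $K$; it means $\bar g(K\cdot,\cdot)=0$ on the subspace for all such $K$. A submanifold $L^{2n}\subset M^{4n}$ (real dimension $2n$) is hyper-Lagrangian if there is a smooth map $J:L\to\mathbb{S}^2$, $x\mapsto J(x)=(\lambda_1(x),\lambda_2(x),\lambda_3(x))$ (the complex phase map), such that for every $x\in L$ the form $\Omega_{\hat J(x)}$, $\hat J(x)=\sum_\alpha\lambda_\alpha(x)J_\alpha$, vanishes on $T_xL$. It is complex Lagrangian if there is a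 constant $\lambda\in\mathbb{S}^2$ such that, for the parallel complex structure $\hat J=\sum_\alpha\lambda_\alpha J_\alpha$, the form $\Omega_{\hat J}$ vanishes on $T_xL$ for every $x\in L$. *)

(* Defs.v *)
From HB Require Import structures.
From mathcomp Require Import all_boot all_order all_algebra.
From mathcomp Require Import all_classical all_reals all_analysis.
From mathcomp Require Import complex ring.

Set Implicit Arguments.
Unset Strict Implicit.
Unset Printing Implicit Defensive.

Import Order.TTheory GRing.Theory Num.Theory.
Import numFieldNormedType.Exports.

Local Open Scope classical_set_scope.
Local Open Scope ring_scope.

(* Coordinates and tangent vectors are column vectors, so that a matrix product
   A *m B is the composite endomorphism "first B, then A". *)

Section Smooth.
Context {R : realType}.

Definition partial {m : nat} {V : normedModType R} (i : 'I_m)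
    (f : 'cV[R]_m -> V) (x : 'cV[R]_m) : V :=
  'D_(delta_mx i 0) f x.

(* U is meant to be open, so that only the values of f on U matter. *)
Fixpoint Ck {m : nat} {V : normedModType R} (k : nat) (U : set 'cV[R]_m)
    (f : 'cV[R]_m -> V) : Prop :=
  match k with
  | 0%N => forall x, U x -> {for x, continuous f}
  | k'.+1 => (forall x, U x -> differentiable f x) /\
             (forall i, Ck k' U (partial i f))
  end.

Definition smooth_on {m : nat} {V : normedModType R} (U : set 'cV[R]_m)
    (f : 'cV[R]_m -> V) : Prop :=
  forall k, Ck k U f.

(* The values of coord outside dom, and of param outside coord @` dom, are
   irrelevant. *)
Record chart (m : nat) (T : topologicalType) := Chart {
  dom : set T;
  coord : T -> 'cV[R]_m;
  param : 'cV[R]_m -> T;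
  dom_open : open dom;
  img_open : open (coord @` dom);
  coordK : forall p, dom p -> param (coord p) = p;
  coord_continuous : forall p, dom p -> {for p, continuous coord};
  param_continuous :
    forall x, (coord @` dom) x -> {for x, continuous param} }.

End Smooth.

Arguments chart R m T : clear implicits.

Definition img (R : realType) (m : nat) (T : topologicalType)
    (c : chart R m T) : set 'cV[R]_m := coord c @` dom c.

(* The atlas need not be maximal: it generates the smooth structure. *)
Record manifold (R : realType) (m : nat) := Manifold {
  space :> topologicalType;
  atlas : set (chart R m space);
  space_hausdorff : hausdorff_space space;
  space_second_countable : @second_countable space;
  space_connected : connected [set: space];
  atlas_cover : forall p : space, exists2 c, atlas c & dom c p;
  atlas_smooth : forall c c', atlas c -> atlas c' ->
    smooth_on (coord c @` (dom c `&` dom c')) (coord c' \o param c) }.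

Definition atlas_at (R : realType) (m : nat) (M : manifold R m) (p : M) :
    set (chart R m M) :=
  [set c | atlas c /\ dom c p].

Section Maps.
Context {R : realType} {l m : nat} {L : manifold R l} {M : manifold R m}.

Definition smooth_function {V : normedModType R} (h : L -> V) : Prop :=
  forall c, atlas c -> smooth_on (img c) (h \o param c).

Definition smooth_map (f : L -> M) : Prop :=
  continuous f /\
  forall c c', atlas c -> atlas c' ->
    smooth_on (coord c @` (dom c `&` f @^-1` dom c')) (coord c' \o f \o param c).

(* The differential of f at x, from T_xL to T_(f x)M, in the charts c and c'. *)
Definition tangent_map (f : L -> M) (x : L) (c : chart R l L)
    (c' : chart R m M) : 'cV[R]_l -> 'cV[R]_m :=
  'd (coord c' \o f \o param c) (coord c x).

Definition immersion (f : L -> M) : Prop :=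
  smooth_map f /\
  forall x c c', atlas_at x c -> atlas_at (f x) c' ->
    injective (tangent_map f x c c').

End Maps.

Definition bilin {R : realType} {m : nat} (G : 'M[R]_m) (u v : 'cV[R]_m) : R :=
  (u^T *m G *m v) 0 0.

(* Tensor fields are given classically, by their components in each chart of
   the atlas (as functions of the coordinates) and their transformation law. *)

Record riemannian_metric (R : realType) (m : nat) (M : manifold R m) :=
  RiemannianMetric {
  gram :> chart R m M -> 'cV[R]_m -> 'M[R]_m;
  gram_smooth : forall c, atlas c -> smooth_on (img c) (gram c);
  gram_sym : forall c x, atlas c -> img c x -> (gram c x)^T = gram c x;
  gram_pos : forall c x, atlas c -> img c x ->
    forall u, u != 0 -> 0 < bilin (gram c x) u u;
  gram_change : forall (p : M) c c', atlas_at p c -> atlas_at p c' ->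
    forall u v,
      bilin (gram c' (coord c' p))
        (tangent_map idfun p c c' u) (tangent_map idfun p c c' v) =
      bilin (gram c (coord c p)) u v }.

Record endo_field (R : realType) (m : nat) (M : manifold R m) := EndoField {
  endo :> chart R m M -> 'cV[R]_m -> 'M[R]_m;
  endo_smooth : forall c, atlas c -> smooth_on (img c) (endo c);
  endo_change : forall (p : M) c c', atlas_at p c -> atlas_at p c' ->
    forall u,
      endo c' (coord c' p) *m tangent_map idfun p c c' u =
      tangent_map idfun p c c' (endo c (coord c p) *m u) }.

Section LeviCivita.
Context {R : realType} {m : nat}.
Implicit Types G A : 'cV[R]_m -> 'M[R]_m.

(* Entry (i, j) of christoffel G k x is
   Gamma^i_(k j) = 1/2 g^(i s) (d_k g_(s j) + d_j g_(s k) - d_s g_(k j)). *)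
Definition christoffel G (k : 'I_m) (x : 'cV[R]_m) : 'M[R]_m :=
  2^-1 *: (invmx (G x) *m
    \matrix_(s, j) (partial k G x s j + partial j G x s k - partial s G x k j)).

(* These symbols are the Levi-Civita ones: torsion-free and metric. *)
Lemma christoffel_torsion_free G (x : 'cV[R]_m) :
  (forall k, (partial k G x)^T = partial k G x) ->
  forall i j k, christoffel G k x i j = christoffel G j x i k.
Proof.
rewrite /christoffel.
suff H (D : 'I_m -> 'M[R]_m) : (forall k, (D k)^T = D k) -> forall i j k,
    (2^-1 *: (invmx (G x) *m \matrix_(s, j) (D k s j + D j s k - D s k j))) i j =
    (2^-1 *: (invmx (G x) *m \matrix_(s, k) (D j s k + D k s j - D s j k))) i k.
  exact: (H (fun k => partial k G x)).
move=> sD i j k.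
rewrite !mxE; congr (_ * _); apply: eq_bigr => s _; rewrite !mxE.
have -> : D s k j = D s j k by rewrite -[in LHS](sD s) mxE.
by rewrite [D k s j + _]addrC.
Qed.

Lemma christoffel_metric G (x : 'cV[R]_m) :
  G x \in unitmx -> (G x)^T = G x ->
  (forall k, (partial k G x)^T = partial k G x) ->
  forall k, partial k G x =
    (christoffel G k x)^T *m G x + G x *m christoffel G k x.
Proof.
rewrite /christoffel; move: (G x) => A uA sA.
suff H (D : 'I_m -> 'M[R]_m) : (forall k, (D k)^T = D k) -> forall k,
    let C := 2^-1 *: (invmx A *m
      \matrix_(s, j) (D k s j + D j s k - D s k j)) in
    D k = C^T *m A + A *m C.
  exact: (H (fun k => partial k G x)).
move=> sD k C.
have sym s i j : D s i j = D s j i by rewrite -[in LHS](sD s) mxE.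
have E : A *m C = 2^-1 *: \matrix_(s, j) (D k s j + D j s k - D s k j).
  by rewrite /C -scalemxAr mulmxA mulmxV // mul1mx.
have -> : C^T *m A = (A *m C)^T by rewrite trmx_mul sA.
rewrite E; apply/matrixP => i j; rewrite !mxE.
rewrite (sym k j i) (sym i j k) (sym j i k).
by move: (D k i j) (D i k j) (D j k i) => a b d; field.
Qed.

(* Covariant derivative of an endomorphism field along the k-th coordinate
   vector field, for the Levi-Civita connection of G. *)
Definition covariant_derivative G A (k : 'I_m) (x : 'cV[R]_m) : 'M[R]_m :=
  partial k A x + christoffel G k x *m A x - A x *m christoffel G k x.

End LeviCivita.

Section Structures.
Context {R : realType} {m : nat} {M : manifold R m}.
Variables (g : riemannian_metric M) (J : endo_field M).

Definition parallel : Prop :=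
  forall c x, atlas c -> img c x ->
    forall k, covariant_derivative (g c) (J c) k x = 0.

Definition orthogonal : Prop :=
  forall c x, atlas c -> img c x ->
    forall u v, bilin (g c x) (J c x *m u) (J c x *m v) = bilin (g c x) u v.

Definition almost_complex : Prop :=
  forall c x, atlas c -> img c x -> J c x *m J c x = - 1%:M.

End Structures.

Record hyperkahler (R : realType) (n : nat) := Hyperkahler {
  hk_space :> manifold R (4 * n);
  hk_metric : riemannian_metric hk_space;
  hk_J1 : endo_field hk_space;
  hk_J2 : endo_field hk_space;
  hk_J1_complex : almost_complex hk_J1;
  hk_J2_complex : almost_complex hk_J2;
  hk_J1_orthogonal : orthogonal hk_metric hk_J1;
  hk_J2_orthogonal : orthogonal hk_metric hk_J2;
  hk_J1_parallel : parallel hk_metric hk_J1;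
  hk_J2_parallel : parallel hk_metric hk_J2;
  hk_anticommute : forall c x, atlas c -> img c x ->
    hk_J1 c x *m hk_J2 c x = - (hk_J2 c x *m hk_J1 c x) }.

Section Phase.
Context {R : realType}.

Definition dot3 (a b : 'rV[R]_3) : R := \sum_(i < 3) a 0 i * b 0 i.

(* Not the unit sphere of the norm of 'rV[R]_3, which is the sup norm. *)
Definition sphere2 : set 'rV[R]_3 := [set a | dot3 a a = 1].

End Phase.

Section HyperLagrangian.
Context {R : realType} {n : nat} {M : hyperkahler R n}.

Definition hk_J (i : 'I_3) (c : chart R (4 * n) M) (x : 'cV[R]_(4 * n)) :
    'M[R]_(4 * n) :=
  tnth [tuple hk_J1 M c x; hk_J2 M c x; hk_J1 M c x *m hk_J2 M c x] i.

Definition hk_comb (a : 'rV[R]_3) (c : chart R (4 * n) M)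
    (x : 'cV[R]_(4 * n)) : 'M[R]_(4 * n) :=
  \sum_(i < 3) a 0 i *: hk_J i c x.

Definition omega (A : 'M[R]_(4 * n)) (c : chart R (4 * n) M)
    (x u v : 'cV[R]_(4 * n)) : R :=
  bilin (hk_metric M c x) (A *m u) v.

(* omega_K + sqrt(-1) omega_(K Jhat), where Jhat and K are the combinations of
   J1, J2, J3 with coefficients lam and mu. *)
Definition Omega (lam mu : 'rV[R]_3) (c : chart R (4 * n) M)
    (x u v : 'cV[R]_(4 * n)) : R[i] :=
  Complex (omega (hk_comb mu c x) c x u v)
          (omega (hk_comb mu c x *m hk_comb lam c x) c x u v).

Definition Omega_vanishes (lam : 'rV[R]_3) (c : chart R (4 * n) M)
    (x : 'cV[R]_(4 * n)) (W : set 'cV[R]_(4 * n)) : Prop :=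
  forall mu, sphere2 mu -> dot3 lam mu = 0 ->
    forall u v, W u -> W v -> Omega lam mu c x u v = 0.

Context {L : manifold R (2 * n)}.

(* Omega_Jhat vanishes on the tangent space of L at x. *)
Definition Omega_vanishes_at (f : L -> M) (lam : 'rV[R]_3) (x : L) : Prop :=
  forall c c', atlas_at x c -> atlas_at (f x) c' ->
    Omega_vanishes lam c' (coord c' (f x)) (range (tangent_map f x c c')).

Definition hyper_lagrangian (f : L -> M) : Prop :=
  exists J : L -> 'rV[R]_3,
    [/\ smooth_function J, forall x, sphere2 (J x) &
        forall x, Omega_vanishes_at f (J x) x].

Definition complex_lagrangian (f : L -> M) : Prop :=
  exists2 lam : 'rV[R]_3, sphere2 lam & forall x, Omega_vanishes_at f lam x.

End HyperLagrangian.

(* Main.v *)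
(* On [L] the 2-forms [omega_i] restrict to [lam_i * theta], where [lam] is the
   phase map and [theta = sum_i lam_i omega_i], because [omega_K] vanishes for
   [K] orthogonal to [lam]. Each [omega_i] is closed since [J_i] is parallel, so
   [d lam_i /\ theta + lam_i * d theta = 0]. Contracting with the unit vector [lam]
   gives [d theta = 0], hence [d lam_i /\ theta = 0]. The tangent spaces of [L] are
   invariant under [Jhat], so [theta] is nondegenerate; in dimension [2n > 2] this
   forces [d lam_i = 0], and [lam] is constant because [L] is connected. *)

Require Import Defs.
From mathcomp Require Import all_boot all_order all_algebra.
From mathcomp Require Import all_classical all_reals all_analysis.
From mathcomp Require Import complex ring.
(* [coord] and [img] would otherwise denote MathComp's constants. *)
Import Defs.

Set Implicit Arguments.
Unset Strict Implicit.
Unset Printing Implicit Defensive.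

Import Order.TTheory GRing.Theory Num.Theory.
Import numFieldNormedType.Exports.

Local Open Scope classical_set_scope.
Local Open Scope ring_scope.

(** * Directional derivatives, the mean value theorem and symmetry of second derivatives *)

Section Calculus.
Context {R : realType} {V : normedModType R}.

Lemma is_derive_line (W : normedModType R) (f : V -> W) x v t df :
  is_derive (x + t *: v) v f df -> is_derive t (1 : R) (fun s => f (x + s *: v)) df.
Proof.
(* The two difference quotients are the same function of [h], so derivability and value transfer
   together. *)
suff E : (fun h : R => h^-1 *: (((fun s => f (x + s *: v)) \o shift t) (h *: (1 : R))
    - f (x + t *: v))) =
    fun h => h^-1 *: ((f \o shift (x + t *: v)) (h *: v) - f (x + t *: v)).
  by case=> dfx <-; split; rewrite /derivable /derive E.
apply/funext => h /=; congr (_ *: (f _ - _)).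
by rewrite [h *: 1]mulr1 scalerDl addrCA.
Qed.

Lemma is_derive_translate (W : normedModType R) (f : V -> W) x v w df :
  is_derive (x + w) v f df -> is_derive x v (fun y => f (y + w)) df.
Proof.
suff E : (fun h : R => h^-1 *: (((fun y => f (y + w)) \o shift x) (h *: v) - f (x + w))) =
    fun h => h^-1 *: ((f \o shift (x + w)) (h *: v) - f (x + w)).
  by case=> dfx <-; split; rewrite /derivable /derive E.
by apply/funext => h /=; rewrite addrA.
Qed.

Lemma is_derive_mx m n (A : V -> 'M[R]_(m, n)) x v (dA : 'M[R]_(m, n)) :
  (forall i j, is_derive x v (fun y => A y i j) (dA i j)) -> is_derive x v A dA.
Proof.
move=> dAij.
have dAx : derivable A x v by apply/derivable_mxP => i j; case: (dAij i j).
split=> //; apply/matrixP => i j; rewrite derive_mx// mxE.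
by case: (dAij i j).
Qed.

Lemma is_derive_entry m n (A : V -> 'M[R]_(m, n)) x v (dA : 'M[R]_(m, n)) i j :
  is_derive x v A dA -> is_derive x v (fun y => A y i j) (dA i j).
Proof.
case=> dAx <-; rewrite derive_mx// mxE; apply/derivableP.
by move/derivable_mxP: dAx; apply.
Qed.

Lemma is_derive_trmx m n (A : V -> 'M[R]_(m, n)) x v (dA : 'M[R]_(m, n)) :
  is_derive x v A dA -> is_derive x v (fun y => (A y)^T) dA^T.
Proof.
move=> dAx; apply: is_derive_mx => i j; rewrite mxE.
rewrite (_ : (fun _ => _) = fun y => A y j i); last by apply/funext => y; rewrite mxE.
exact: is_derive_entry.
Qed.

Lemma is_derive_mulmx m n p (A : V -> 'M[R]_(m, n)) (B : V -> 'M[R]_(n, p)) x v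
    (dA : 'M[R]_(m, n)) (dB : 'M[R]_(n, p)) :
  is_derive x v A dA -> is_derive x v B dB ->
  is_derive x v (fun y => A y *m B y) (dA *m B x + A x *m dB).
Proof.
move=> dAx dBx; apply: is_derive_mx => i j.
rewrite (_ : (fun _ => _) = \sum_k ((fun y => A y i k) * (fun y => B y k j))); last first.
  by apply/funext => y; rewrite mxE fct_sumE.
rewrite !mxE -big_split/=; apply: is_derive_sum => k.
have dAik := is_derive_entry i k dAx; have dBkj := is_derive_entry k j dBx.
by apply: is_derive_eq; rewrite addrC [dA i k * _]mulrC.
Qed.

Lemma MVT_line (h : V -> R) x v t (dh : V -> R) :
  0 <= t -> (forall s, 0 <= s <= t -> is_derive (x + s *: v) v h (dh (x + s *: v))) ->
  exists2 s, 0 <= s <= t & h (x + t *: v) - h x = dh (x + s *: v) * t.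
Proof.
move=> t0 dhx.
have dhl s : s \in `[0, t] -> is_derive s (1 : R) (fun s => h (x + s *: v)) (dh (x + s *: v)).
  by rewrite in_itv => st; apply: is_derive_line; exact: dhx.
pose k s := h (x + s *: v).
have dk s : s \in `]0, t[ -> is_derive s (1 : R) k (dh (x + s *: v)).
  by move=> /subset_itv_oo_cc; exact: dhl.
have ck : {within `[0, t], continuous k}.
  by apply: derivable_within_continuous => s /dhl[].
have [s st E] := MVT_segment t0 dk ck.
exists s; first by move: st; rewrite in_itv.
by move: E; rewrite /k scale0r addr0 subr0.
Qed.

(** The mean value theorem is applied along [u] to the difference of [h] and its translate by
    [t *: v], then along [v] to [hu]. *)
Lemma second_difference (h hu huv : V -> R) x u v t :
  0 <= t ->
  (forall s r, 0 <= s <= t -> 0 <= r <= t ->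
     is_derive (x + s *: u + r *: v) u h (hu (x + s *: u + r *: v)) /\
     is_derive (x + s *: u + r *: v) v hu (huv (x + s *: u + r *: v))) ->
  exists s r, [/\ 0 <= s <= t, 0 <= r <= t &
   h (x + t *: u + t *: v) - h (x + t *: u) - (h (x + t *: v) - h x) =
   huv (x + s *: u + r *: v) * t * t].
Proof.
move=> t0 H.
have t00 : 0 <= t <= t by rewrite lexx t0.
have z0 : 0 <= (0 : R) <= t by rewrite lexx t0.
have [|s st E] := @MVT_line (fun y => h (y + t *: v) - h y) x u t
    (fun y => hu (y + t *: v) - hu y) t0.
  move=> s st; apply: is_deriveB.
    have [dh _] := H s t st t00.
    exact: is_derive_translate.
  by have [+ _] := H s 0 st z0; rewrite scale0r addr0.
have [|r rt E'] := @MVT_line hu (x + s *: u) v t huv t0.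
  by move=> r rt; have [] := H s r st rt.
by exists s, r; split => //; rewrite E E'.
Qed.

(* Schwarz: the same second difference of [h] is computed by the mean value
   theorem in either order. *)
Lemma derive_commute (h hu hv huv hvu : V -> R) x u v :
  (\forall y \near x, [/\ is_derive y u h (hu y), is_derive y v h (hv y),
     is_derive y v hu (huv y) & is_derive y u hv (hvu y)]) ->
  {for x, continuous huv} -> {for x, continuous hvu} -> huv x = hvu x.
Proof.
move=> dh /cvgrPdist_le cA /cvgrPdist_le cB.
apply/eqP; rewrite -subr_eq0 -normr_le0; apply/ler_addgt0Pl => e e0; rewrite addr0.
have e20 : 0 < e / 2 by rewrite divr_gt0.
pose P y := [/\ [/\ is_derive y u h (hu y), is_derive y v h (hv y),
     is_derive y v hu (huv y) & is_derive y u hv (hvu y)],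
     `|huv x - huv y| <= e / 2 & `|hvu x - hvu y| <= e / 2].
have /nbhs_ballP[d /= d0 xd] : nbhs x P.
  exact: filterS3 (fun y a b c => And3 a b c) dh (cA _ e20) (cB _ e20).
have near_x y : `|x - y| < d -> P y by move=> xy; apply: xd; rewrite -ball_normE.
have c0 : 0 < 1 + (`|u| + `|v|) by rewrite ltr_pwDl// addr_ge0.
(* The parallelogram with sides [t *: u] and [t *: v] stays within [d] of [x]; the summand [1] keeps
   the denominator positive and the bound strict. *)
pose t := d / (1 + (`|u| + `|v|)).
have t0 : 0 < t by rewrite divr_gt0.
have small s r : 0 <= s <= t -> 0 <= r <= t -> `|x - (x + s *: u + r *: v)| < d.
  move=> /andP[s0 st] /andP[r0 rt]; rewrite distrC -[x + _ + _]addrA [x + _]addrC addrK.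
  apply: (@le_lt_trans _ _ (t * (`|u| + `|v|))).
    rewrite (le_trans (ler_normD _ _))// !normrZ mulrDr.
    by rewrite !ger0_norm// lerD// ler_wpM2r.
  rewrite -[ltRHS](@divfK _ (1 + (`|u| + `|v|))) ?gt_eqF// -/t.
  by rewrite ltr_pM2l// ltrDr.
have [|s1 [r1 [s1t r1t E1]]] := @second_difference h hu huv x u v t (ltW t0).
  by move=> s r st rt; have [[]] := near_x _ (small s r st rt).
have [|r2 [s2 [r2t s2t E2]]] := @second_difference h hv hvu x v u t (ltW t0).
  move=> r s rt st; have [[]] := near_x _ (small s r st rt).
  by rewrite addrAC.
have E : huv (x + s1 *: u + r1 *: v) = hvu (x + s2 *: u + r2 *: v).
  have tn0 : t != 0 by rewrite gt_eqF.
  apply: (mulIf tn0); apply: (mulIf tn0).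
  rewrite -E1 [in RHS]addrAC -E2 [x + t *: v + t *: u]addrAC.
  ring.
have [_ A1 _] := near_x _ (small s1 r1 s1t r1t).
have [_ _ B2] := near_x _ (small s2 r2 s2t r2t).
rewrite -(subrKA (huv (x + s1 *: u + r1 *: v))) (splitr e).
rewrite (le_trans (ler_normD _ _))// lerD// E distrC.
exact: B2.
Qed.

(** The segment from [x] to a point of a ball around [x] stays in that ball, so the mean value
    theorem applies along it. *)
Lemma locally_constant (h : V -> R) x :
  (\forall y \near x, forall v, is_derive y v h 0) ->
  \forall y \near x, h y = h x.
Proof.
case/nbhs_ballP => d d0 xd; apply/nbhs_ballP; exists d => // y.
rewrite -ball_normE /= => xy.
have [|s _] := @MVT_line h x (y - x) 1 (cst 0) ler01.
  move=> s /andP[s0 s1]; apply: xd; rewrite -ball_normE /=.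
  rewrite opprD addrA subrr add0r normrN normrZ ger0_norm// distrC.
  by rewrite (le_lt_trans _ xy)// ler_piMl.
by rewrite scale1r mul0r [x + _]addrC subrK => /eqP; rewrite subr_eq0 => /eqP.
Qed.

(** Keeping the derivative of [g] along ['D_v F x] lets [derive_partial] expand it in the target
    coordinates, where the Christoffel symbols live. *)
Lemma is_derive_comp (W Z : normedModType R) (F : V -> W) (g : W -> Z) x v :
  differentiable F x -> differentiable g (F x) ->
  is_derive x v (g \o F) ('D_('D_v F x) g (F x)).
Proof.
move=> dF dg; have dgF : differentiable (g \o F) x by exact: differentiable_comp.
apply: DeriveDef; first exact: diff_derivable.
by rewrite !deriveE// diff_comp.
Qed.

End Calculus.

(** * Coordinate derivatives of smooth maps *)

Section Coordinates.
Context {R : realType} {m : nat} {W : normedModType R}.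

Lemma derive_partial (f : 'cV[R]_m -> W) x v :
  differentiable f x -> 'D_v f x = \sum_i v i 0 *: partial i f x.
Proof.
move=> df; rewrite deriveE// {1}[v]matrix_sum_delta linear_sum/=.
apply: eq_bigr => i _; rewrite big_ord1 linearZ/=.
by rewrite /partial deriveE.
Qed.

Lemma smooth_on_differentiable (U : set 'cV[R]_m) (f : 'cV[R]_m -> W) x :
  smooth_on U f -> U x -> differentiable f x.
Proof. by move=> /(_ 1%N)[+ _]; apply. Qed.

Lemma smooth_on_partial (U : set 'cV[R]_m) (f : 'cV[R]_m -> W) i :
  smooth_on U f -> smooth_on U (partial i f).
Proof. by move=> sf k; have [_] := sf k.+1; apply. Qed.

Lemma smooth_on_is_derive (U : set 'cV[R]_m) (f : 'cV[R]_m -> W) x i :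
  smooth_on U f -> U x -> is_derive x (delta_mx i 0) f (partial i f x).
Proof.
by move=> sf Ux; apply/derivableP/diff_derivable/(smooth_on_differentiable sf).
Qed.

End Coordinates.

(** Schwarz's theorem is used on each real component of [F]; openness of [U] supplies the
    derivatives near [x]. *)
Lemma partial_commute (R : realType) (l m : nat) (U : set 'cV[R]_l)
    (F : 'cV[R]_l -> 'cV[R]_m) x a b :
  open U -> smooth_on U F -> U x ->
  partial a (partial b F) x = partial b (partial a F) x.
Proof.
move=> oU sF Ux; apply/matrixP => i j; rewrite ord1.
have c2 a' b' : {for x, continuous (fun y => partial a' (partial b' F) y i 0)}.
  have /(_ 0%N x Ux) cF : smooth_on U (partial a' (partial b' F)).
    by do 2!apply: smooth_on_partial.
  exact: (@continuous_comp _ _ _ _ (fun A : 'cV[R]_m => A i 0) _ cF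
    (@matrix_normedtype.coord_continuous _ _ _ _ _ _)).
apply: (@derive_commute R _ (fun y => F y i 0) (fun y => partial b F y i 0)
  (fun y => partial a F y i 0) (fun y => partial a (partial b F) y i 0)
  (fun y => partial b (partial a F) y i 0) x (delta_mx b 0) (delta_mx a 0)) => //.
near=> y; have Uy : U y by near: y; exact: open_nbhs_nbhs.
by split; apply: is_derive_entry; apply: (smooth_on_is_derive _ _ Uy) => //;
  apply: smooth_on_partial.
Unshelve. all: by end_near. Qed.

(** * Linear algebra of skew forms and of combinations of complex structures *)

Section LinearAlgebra.
Context {R : realType}.

(** [z^T D^T G D z] is the squared [G]-length of [D z]. *)
Lemma definite_kernel m p (G : 'M[R]_m) (D : 'M[R]_(m, p)) (z : 'cV[R]_p) :
  (forall u, u != 0 -> 0 < bilin G u u) -> D^T *m G *m D *m z = 0 -> D *m z = 0.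
Proof.
move=> G_pos E; apply/eqP/negPn/negP => /G_pos.
rewrite /bilin trmx_mul.
have -> : z^T *m D^T *m G *m (D *m z) = z^T *m (D^T *m G *m D *m z).
  by rewrite !mulmxA.
by rewrite E mulmx0 mxE ltxx.
Qed.

(* [D] and [K *m D] span complementary [G]-orthogonal subspaces, and the image
   under [J] of a vector in the kernel is orthogonal to both. *)
Lemma lagrangian_nondegenerate n (G J K : 'M[R]_(4 * n)) (D : 'M[R]_(4 * n, 2 * n)) :
  (forall u, u != 0 -> 0 < bilin G u u) ->
  (forall z : 'cV_(2 * n), D *m z = 0 -> z = 0) ->
  J^T *m G = - (G *m J) -> K^T *m G = - (G *m K) ->
  J *m J = - 1%:M -> K *m K = - 1%:M -> J *m K = - (K *m J) ->
  D^T *m (K^T *m G) *m D = 0 -> D^T *m ((K *m J)^T *m G) *m D = 0 ->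
  forall z : 'cV_(2 * n), D^T *m (J^T *m G) *m D *m z = 0 -> z = 0.
Proof.
move=> G_pos D_inj JG KG JJ KK JK DKD DKJD z Jz.
have GK : D^T *m G *m K *m D = 0.
  by apply: oppr_inj; rewrite oppr0 -[RHS]DKD KG mulmxN mulNmx -!mulmxA.
have G0 (u : 'cV_(4 * n)) : G *m u = 0 -> u = 0.
  move=> Gu; apply/eqP/negPn/negP => /G_pos.
  by rewrite /bilin -mulmxA Gu mulmx0 mxE ltxx.
pose S := row_mx D (K *m D).
have S_inj (w : 'cV_(2 * n + 2 * n)) : S *m w = 0 -> w = 0.
  rewrite -[w]vsubmxK mul_row_col; move: (usubmx w) (dsubmx w) => a b E.
  have Da : D *m a = 0.
    apply: (definite_kernel G_pos).
    have := congr1 (mulmx (D^T *m G)) E.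
    by rewrite mulmx0 mulmxDr !mulmxA GK mul0mx addr0.
  have Db : D *m b = 0.
    have : K *m (D *m b) = 0 by move: E; rewrite Da add0r mulmxA.
    move/(congr1 (mulmx K)); rewrite mulmx0 mulmxA KK mulNmx mul1mx.
    by move/eqP; rewrite oppr_eq0 => /eqP.
  by rewrite (D_inj _ Da) (D_inj _ Db) col_mx0.
(* By the count [2n + 2n = 4n] the rows of [S^T] span everything, so a vector annihilated by [S^T]
   is zero. *)
have S_full : row_full S^T.
  have /eqP rS : row_free S^T.
    apply: inj_row_free => v /(congr1 trmx); rewrite trmx_mul trmxK trmx0.
    by move/S_inj/(congr1 trmx); rewrite trmxK trmx0.
  by rewrite /row_full rS -mulnDl.
have /row_full_inj/(_ (G *m (J *m (D *m z))) 0) := S_full.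
rewrite mulmx0 tr_row_mx mul_col_mx => H.
have JJDz : J *m (J *m (D *m z)) = - (D *m z) by rewrite mulmxA JJ mulNmx mul1mx.
suff JDz : J *m (D *m z) = 0.
  by apply: D_inj; apply: oppr_inj; rewrite oppr0 -JJDz JDz mulmx0.
apply/G0/H; rewrite -[0 in RHS]vsubmxK !linear0; congr col_mx.
  apply: oppr_inj; rewrite oppr0 -[RHS]Jz JG mulmxN !mulNmx.
  by rewrite !mulmxA.
(* Skewness of both structures and anticommutation identify [K^T G J] with the form of [K J], which
   vanishes on the image of [D]. *)
have KJG : (K *m J)^T *m G = K^T *m G *m J.
  rewrite trmx_mul -[LHS]mulmxA KG mulmxN mulmxA JG !mulNmx opprK.
  by rewrite -!mulmxA JK mulmxN.
by rewrite -[RHS](mul0mx _ z) -DKJD KJG trmx_mul !mulmxA.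
Qed.

(** Contraction with the inverse of [T] over [b] and [c] turns the first term into [N * l a] and
    each other term into [- l a], leaving [(N - 2) * l a = 0]. Thus wedging 1-forms with a
    nondegenerate 2-form is injective in dimension above 2. *)
Lemma skew_wedge_eq0 N (T : 'M[R]_N) (l : 'I_N -> R) :
  (2 < N)%N -> T^T = - T -> T \in unitmx ->
  (forall a b c, l a * T b c + l b * T c a + l c * T a b = 0) ->
  forall a, l a = 0.
Proof.
move=> N2 T_skew T_unit H a.
pose E := invmx T.
have TE b c : \sum_k T b k * E k c = (b == c)%:R.
  by have := mulmxV T_unit => /matrixP/(_ b c); rewrite !mxE.
have ET b c : \sum_k E b k * T k c = (b == c)%:R.
  by have := mulVmx T_unit => /matrixP/(_ b c); rewrite !mxE.
have TC b c : T b c = - T c b.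
  by have := congr1 (fun A : 'M[R]_N => A c b) T_skew; rewrite !mxE.
have : \sum_b \sum_c (l a * T b c + l b * T c a + l c * T a b) * E c b = 0.
  by rewrite big1// => b _; rewrite big1// => c _; rewrite H mul0r.
under eq_bigr do under eq_bigr do rewrite !mulrDl.
under eq_bigr do rewrite !big_split/=.
rewrite !big_split/=.
have -> : \sum_b \sum_c l a * T b c * E c b = l a * N%:R.
  transitivity (\sum_(b < N) l a).
    apply: eq_bigr => b _.
    transitivity (l a * \sum_k T b k * E k b); last by rewrite TE eqxx mulr1.
    rewrite mulr_sumr.
    by apply: eq_bigr => c _; rewrite mulrA.
  by rewrite sumr_const card_ord mulr_natr.
have -> : \sum_b \sum_c l b * T c a * E c b = - l a.
  transitivity (\sum_b - l b * (a == b)%:R).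
    apply: eq_bigr => b _; rewrite -(TE a b) mulr_sumr.
    by apply: eq_bigr => c _; rewrite (TC c a); ring.
  rewrite (bigD1 a)//= eqxx mulr1 big1 ?addr0// => b ba.
  by rewrite eq_sym (negbTE ba) mulr0.
have -> : \sum_b \sum_c l c * T a b * E c b = - l a.
  rewrite exchange_big /=.
  transitivity (\sum_c - l c * (c == a)%:R).
    apply: eq_bigr => c _; rewrite -(ET c a) mulr_sumr.
    apply: eq_bigr => b _; rewrite (TC a b); ring.
  rewrite (bigD1 a)//= eqxx mulr1 big1 ?addr0// => b ba.
  by rewrite (negbTE ba) mulr0.
move=> E0.
have : l a * (N - 2)%:R = 0.
  rewrite natrB ?(ltnW N2)// -[RHS]E0; ring.
move/eqP; rewrite mulf_eq0 pnatr_eq0 subn_eq0 leqNgt N2 orbF.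
by move/eqP.
Qed.

Lemma dot3C (a b : 'rV[R]_3) : dot3 a b = dot3 b a.
Proof. by apply: eq_bigr => i _; rewrite mulrC. Qed.

(** If the first two coordinates of [a] vanish, the first basis vector works; otherwise their
    quarter turn is normalised. *)
Lemma exists_orthogonal_unit (a : 'rV[R]_3) :
  exists2 b, sphere2 b & dot3 a b = 0.
Proof.
have [/eqP|] := eqVneq (a 0 0 ^+ 2 + a 0 1 ^+ 2) 0.
  rewrite paddr_eq0 ?sqr_ge0// !expf_eq0/= => /andP[/eqP a0 /eqP a1].
  exists (delta_mx 0 0); rewrite /sphere2/= /dot3 !big_ord_recl big_ord0 !mxE/=.
    by rewrite !mulr0 mulr1 !addr0.
  by rewrite a0 !mulr0 mul0r !addr0.
set s := _ + _ => s0.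
have {}s0 : 0 < s by rewrite lt_def s0 addr_ge0 ?sqr_ge0.
pose r := Num.sqrt s.
have r0 : r != 0 by rewrite gt_eqF ?sqrtr_gt0.
have rr : r ^+ 2 = s by rewrite sqr_sqrtr ?ltW.
exists (\row_i (if i == 0 then - (a 0 1 / r) else if i == 1 then a 0 0 / r else 0)).
  rewrite /sphere2/= /dot3 !big_ord_recl big_ord0 !mxE/=.
  transitivity (s / r ^+ 2); last by rewrite rr divff ?gt_eqF.
  by rewrite /s; field.
rewrite /dot3 !big_ord_recl big_ord0 !mxE/=.
rewrite (_ : lift ord0 ord0 = 1); last exact: val_inj.
by field.
Qed.

Lemma sphere2_normalize (a : 'rV[R]_3) :
  a != 0 -> sphere2 ((Num.sqrt (dot3 a a))^-1 *: a).
Proof.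
move=> a0.
have d0 : 0 < dot3 a a.
  rewrite lt_def sumr_ge0 ?andbT; last by move=> i _; rewrite -expr2 sqr_ge0.
  apply: contra a0 => /eqP/psumr_eq0P E; apply/eqP/rowP => i; rewrite mxE.
  apply/eqP; rewrite -sqrf_eq0 expr2 E// => j _.
  by rewrite -expr2 sqr_ge0.
rewrite /sphere2/= {1}/dot3.
transitivity ((Num.sqrt (dot3 a a))^-2 * dot3 a a).
  rewrite [in RHS]/dot3 mulr_sumr; apply: eq_bigr => i _; rewrite !mxE.
  by rewrite -exprVn; ring.
by rewrite sqr_sqrtr ?ltW// mulVf ?gt_eqF.
Qed.

(** Scaling extends the hypothesis to every [mu] orthogonal to [lam]; it is then used for the
    component of the [i]-th basis vector orthogonal to [lam]. *)
Lemma vanishing_on_orthogonal (W : lmodType R) (P : 'I_3 -> W) (lam : 'rV[R]_3) :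
  sphere2 lam ->
  (forall mu, sphere2 mu -> dot3 lam mu = 0 -> \sum_i mu 0 i *: P i = 0) ->
  forall i, P i = lam 0 i *: \sum_j lam 0 j *: P j.
Proof.
move=> lam1 H i.
have H' mu : dot3 lam mu = 0 -> \sum_i mu 0 i *: P i = 0.
  have [-> _|mu0 lmu] := eqVneq mu 0.
    by rewrite big1// => j _; rewrite mxE scale0r.
  have mu1 := sphere2_normalize mu0.
  set r := (Num.sqrt _)^-1 in mu1.
  have r0 : r != 0.
    apply/eqP => r0; move: mu1; rewrite r0 scale0r /sphere2/= /dot3 big1.
      by move/eqP; rewrite eq_sym oner_eq0.
    by move=> j _; rewrite mxE mul0r.
  apply: (scalerI r0); rewrite scaler0 -[RHS](H _ mu1).
    by rewrite scaler_sumr; apply: eq_bigr => j _; rewrite mxE scalerA.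
  rewrite -[RHS](mulr0 r) -lmu /dot3 mulr_sumr; apply: eq_bigr => j _.
  by rewrite mxE mulrCA.
apply/eqP; rewrite -subr_eq0; apply/eqP.
transitivity (\sum_j (delta_mx 0 i - lam 0 i *: lam) 0 j *: P j).
  under [RHS]eq_bigr do rewrite !mxE eqxx/= scalerBl -scalerA.
  rewrite sumrB -scaler_sumr; congr (_ - _); rewrite (bigD1 i)//= eqxx scale1r.
  by rewrite big1 ?addr0// => j /negbTE->; rewrite scale0r.
apply: H'.
rewrite /dot3; under eq_bigr do rewrite !mxE eqxx/= mulrBr mulrCA.
rewrite sumrB -mulr_sumr [X in _ * X]lam1 mulr1 (bigD1 i)//= eqxx mulr1.
by rewrite big1 ?addr0 ?subrr// => j /negbTE->; rewrite mulr0.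
Qed.

(** Exchanging the sums in the second product pairs [e i *m e j] with [e j *m e i], so only [i = j]
    survives. The case [a = b] gives squares, orthogonal [a] and [b] give anticommutation. *)
Lemma clifford_comb m (e : 'I_3 -> 'M[R]_m) (a b : 'rV[R]_3) :
  (forall i j, e i *m e j + e j *m e i = (- 2 * (i == j)%:R)%:M) ->
  (\sum_i a 0 i *: e i) *m (\sum_i b 0 i *: e i) +
  (\sum_i b 0 i *: e i) *m (\sum_i a 0 i *: e i) = (- 2 * dot3 a b)%:M.
Proof.
move=> he; rewrite !mulmx_suml.
under eq_bigr do rewrite mulmx_sumr.
under [X in _ + X]eq_bigr do rewrite mulmx_sumr.
rewrite [X in _ + X]exchange_big/= -big_split/= /dot3 mulr_sumr raddf_sum.
apply: eq_bigr => i _; rewrite -big_split/=.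
under eq_bigr => j _.
  rewrite -!scalemxAl -!scalemxAr !scalerA [b 0 j * _]mulrC -scalerDr he.
  rewrite scale_scalar_mx; over.
rewrite (bigD1 i)//= eqxx big1 ?addr0.
  by congr (_%:M); rewrite mulr1; ring.
move=> j ji; rewrite eq_sym (negbTE ji) !mulr0; apply/matrixP => k l.
by rewrite !mxE mul0rn.
Qed.

End LinearAlgebra.

(** * Differentiation of parallel bilinear forms and closedness of their pullbacks *)

Section BilinearForms.
Context {R : realType} {m : nat}.
Implicit Types (W : 'M[R]_m) (u v w : 'cV[R]_m).

Lemma bilinDl W u v w : bilin W (u + v) w = bilin W u w + bilin W v w.
Proof. by rewrite /bilin linearD/= !mulmxDl mxE. Qed.

Lemma bilinDr W u v w : bilin W u (v + w) = bilin W u v + bilin W u w.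
Proof. by rewrite /bilin mulmxDr mxE. Qed.

Lemma bilin_tr W u v : bilin W^T u v = bilin W v u.
Proof.
rewrite /bilin; have -> : u^T *m W^T *m v = (v^T *m W *m u)^T.
  by rewrite !trmx_mul trmxK mulmxA.
by rewrite [LHS]mxE.
Qed.

Lemma bilinN W u v : bilin (- W) u v = - bilin W u v.
Proof. by rewrite /bilin mulmxN mulNmx mxE. Qed.

Lemma is_derive_bilin (V : normedModType R) (W : V -> 'M[R]_m)
    (f h : V -> 'cV[R]_m) x e dW df dh :
  is_derive x e W dW -> is_derive x e f df -> is_derive x e h dh ->
  is_derive x e (fun y => bilin (W y) (f y) (h y))
    (bilin dW (f x) (h x) + bilin (W x) df (h x) + bilin (W x) (f x) dh).
Proof.
move=> dWx dfx dhx.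
have := is_derive_mulmx (is_derive_mulmx (is_derive_trmx dfx) dWx) dhx.
move/(is_derive_entry 0 0)/is_derive_eq; apply.
by rewrite /bilin mulmxDl !mxE [X in X + _ = _]addrC.
Qed.

(** The hypotheses say that [G] and [A] are parallel; the two terms [A^T C^T G] cancel, so the form
    [A^T G] is parallel too. *)
Lemma is_derive_metric_form (V : normedModType R) (G A : V -> 'M[R]_m) (C : 'M[R]_m) x e :
  is_derive x e G (C^T *m G x + G x *m C) ->
  is_derive x e A (A x *m C - C *m A x) ->
  is_derive x e (fun y => (A y)^T *m G y)
    (C^T *m ((A x)^T *m G x) + (A x)^T *m G x *m C).
Proof.
move=> dG dA; have := is_derive_mulmx (is_derive_trmx dA) dG.
move/is_derive_eq; apply.
rewrite linearB/= !trmx_mul mulmxBl mulmxDr !mulmxA.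
by rewrite addrA subrK.
Qed.

(** The commutator with [C] is a derivation. This handles the third structure, a product of the
    first two. *)
Lemma is_derive_parallel_comp (V : normedModType R) (A B : V -> 'M[R]_m) (C : 'M[R]_m) x e :
  is_derive x e A (A x *m C - C *m A x) ->
  is_derive x e B (B x *m C - C *m B x) ->
  is_derive x e (fun y => A y *m B y) (A x *m B x *m C - C *m (A x *m B x)).
Proof.
move=> dA dB; have := is_derive_mulmx dA dB.
move/is_derive_eq; apply.
by rewrite mulmxBl mulmxBr !mulmxA addrC addrA subrK.
Qed.

(* With [f a = d_a F] and [h a b = d_a d_b F], the covariant Hessian
   [B a b = d_a d_b F + Gamma(d_a F, d_b F)] of [F] is symmetric, and for a
   parallel form [W] one has
   [d_a (W (d_b F) (d_c F)) = W (B a b) (d_c F) + W (d_b F) (B a c)];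
   the cyclic sum of these expressions vanishes when [W] is skew. *)
Lemma pullback_closed (V : normedModType R) l (e : 'I_l -> V) (f : 'I_l -> V -> 'cV[R]_m)
    (h : 'I_l -> 'I_l -> 'cV[R]_m) (W : V -> 'M[R]_m) (Gamma : 'cV[R]_m -> 'M[R]_m) x :
  (forall a b, is_derive x (e a) (f b) (h a b)) ->
  (forall a b, h a b = h b a) ->
  (forall u v, Gamma u *m v = Gamma v *m u) ->
  (forall a, is_derive x (e a) W ((Gamma (f a x))^T *m W x + W x *m Gamma (f a x))) ->
  (W x)^T = - W x ->
  exists dW : 'I_l -> 'I_l -> 'I_l -> R,
    (forall a b c, is_derive x (e a) (fun y => bilin (W y) (f b y) (f c y)) (dW a b c)) /\
    forall a b c, dW a b c + dW b c a + dW c a b = 0.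
Proof.
move=> df hC GC dW W_skew.
have [B BE] : exists B : 'I_l -> 'I_l -> 'cV[R]_m, forall a b,
    B a b = h a b + Gamma (f a x) *m f b x by eexists.
have BC a b : B a b = B b a by rewrite !BE hC GC.
have skew u v : bilin (W x) u v = - bilin (W x) v u by rewrite -bilin_tr W_skew bilinN.
exists (fun a b c => bilin (W x) (B a b) (f c x) + bilin (W x) (f b x) (B a c)).
split=> [a b c|a b c].
  have := is_derive_bilin (dW a) (df a b) (df a c).
  move/is_derive_eq; apply.
  rewrite [X in X + _ + _](_ : _ = bilin (W x) (Gamma (f a x) *m f b x) (f c x) +
      bilin (W x) (f b x) (Gamma (f a x) *m f c x)); last first.
    by rewrite /bilin mulmxDr mulmxDl mxE trmx_mul !mulmxA.
  rewrite !BE bilinDl bilinDr.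
  move: (bilin _ _ _) (bilin _ _ _) (bilin _ _ _) (bilin _ _ _) => p q r s; ring.
rewrite (skew (f b x) (B a c)) (skew (f c x) (B b a)) (skew (f a x) (B c b)).
rewrite (BC b a) (BC c a) (BC c b).
move: (bilin _ _ _) (bilin _ _ _) (bilin _ _ _) => p q r; ring.
Qed.

End BilinearForms.

(** * The differential equation satisfied by the phase *)

Lemma unit_contract (R : realType) (k : nat) (l d1 d2 d3 : 'I_k -> R) (t u1 u2 u3 : R) :
  (forall i, l i * t + (d1 i * u1 + d2 i * u2 + d3 i * u3) = 0) ->
  \sum_i l i * l i = 1 -> \sum_i l i * d1 i = 0 -> \sum_i l i * d2 i = 0 ->
  \sum_i l i * d3 i = 0 -> t = 0.
Proof.
move=> H l1 ld1 ld2 ld3.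
transitivity (\sum_i l i * (l i * t + (d1 i * u1 + d2 i * u2 + d3 i * u3))).
  under eq_bigr do rewrite !mulrDr !mulrA.
  by rewrite !big_split/= -!mulr_suml l1 ld1 ld2 ld3 mul1r !mul0r !addr0.
by rewrite big1// => i _; rewrite H mulr0.
Qed.

(* [lam i * theta] closed for each [i] gives [d (lam i) /\ theta + lam i * d theta = 0];
   contracting with [lam] kills the first term since [|lam| = 1], so [d theta = 0]
   and then [d (lam i) /\ theta = 0]. *)
Lemma phase_derivative_eq0 (R : realType) (N : nat) (lam : 'cV[R]_N -> 'rV[R]_3)
    (p : 'I_3 -> 'I_N -> 'I_N -> 'cV[R]_N -> R) x :
  (2 < N)%N ->
  (\forall y \near x, sphere2 (lam y)) ->
  (\forall y \near x, forall i b c,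
     p i b c y = lam y 0 i * \sum_j lam y 0 j * p j b c y) ->
  (forall a, derivable lam x (delta_mx a 0)) ->
  (forall i, exists dp : 'I_N -> 'I_N -> 'I_N -> R,
    (forall a b c, is_derive x (delta_mx a 0) (p i b c) (dp a b c)) /\
    forall a b c, dp a b c + dp b c a + dp c a b = 0) ->
  let T := \matrix_(b, c) \sum_j lam x 0 j * p j b c x in
  T^T = - T -> T \in unitmx ->
  forall a, partial a lam x = 0.
Proof.
move=> N2 lam1 pE dlam /choice[dp dpP] T T_skew T_unit.
pose dl a := partial a lam x.
have dlE a i : is_derive x (delta_mx a 0) (fun y => lam y 0 i) (dl a 0 i).
  by apply: is_derive_entry; exact/derivableP.
have dp' i a b c : is_derive x (delta_mx a 0) (p i b c) (dp i a b c).
  by have [+ _] := dpP i; apply.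
pose theta b c y := \sum_j lam y 0 j * p j b c y.
pose dtheta a b c := \sum_j (lam x 0 j * dp j a b c + p j b c x * dl a 0 j).
have dth a b c : is_derive x (delta_mx a 0) (theta b c) (dtheta a b c).
  rewrite (_ : theta b c = \sum_j ((fun y => lam y 0 j) * p j b c)); last first.
    by apply/funext => y; rewrite fct_sumE.
  by apply: is_derive_sum => j; exact: is_deriveM.
(* This differentiates [|lam|^2 = 1], which holds near [x]. *)
have lam_dl a : \sum_i lam x 0 i * dl a 0 i = 0.
  have dd : is_derive x (delta_mx a 0) (\sum_i ((fun y => lam y 0 i) * (fun y => lam y 0 i)))
      (\sum_i (lam x 0 i * dl a 0 i + lam x 0 i * dl a 0 i)).
    by apply: is_derive_sum => i; exact: is_deriveM.
  have d0 : is_derive x (delta_mx a 0)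
      (\sum_i ((fun y => lam y 0 i) * (fun y => lam y 0 i))) 0.
    apply: (@near_eq_is_derive R _ _ (cst (1 : R))).
    by near=> y; rewrite fct_sumE /=; apply/esym; near: y.
  have : \sum_i (lam x 0 i * dl a 0 i + lam x 0 i * dl a 0 i) = 0.
    by rewrite -(@derive_val _ _ _ _ _ _ _ dd) (@derive_val _ _ _ _ _ _ _ d0).
  rewrite big_split/= -mulr2n => /eqP.
  by rewrite mulrn_eq0/= => /eqP.
(* Near [x] the function [p i b c] equals [lam_i * theta b c], so the product rule computes its
   derivative. *)
have dpE i a b c : dp i a b c = lam x 0 i * dtheta a b c + theta b c x * dl a 0 i.
  have d1 : is_derive x (delta_mx a 0) ((fun y => lam y 0 i) * theta b c)
      (lam x 0 i * dtheta a b c + theta b c x * dl a 0 i).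
    exact: is_deriveM.
  have d2 := dp' i a b c.
  rewrite -(@derive_val _ _ _ _ _ _ _ d1) -(@derive_val _ _ _ _ _ _ _ d2).
  by apply: near_eq_derive; near=> y; near: y; apply: filterS pE => y ->.
have TE b c : T b c = theta b c x by rewrite mxE.
(* The cyclic sum of [dpE] is the component of [lam_i * d theta + d lam_i /\ theta] on three
   coordinate vectors. *)
have S i a b c : lam x 0 i * (dtheta a b c + dtheta b c a + dtheta c a b) +
   (dl a 0 i * T b c + dl b 0 i * T c a + dl c 0 i * T a b) = 0.
  have [_ /(_ a b c) dp0] := dpP i; rewrite -[RHS]dp0 !dpE !TE.
  have aux (q t1 t2 t3 u1 u2 u3 d1 d2 d3 : R) :
    q * (t1 + t2 + t3) + (d1 * u1 + d2 * u2 + d3 * u3) =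
    (q * t1 + u1 * d1) + (q * t2 + u2 * d2) + (q * t3 + u3 * d3) by ring.
  exact: aux.
have dth0 a b c : dtheta a b c + dtheta b c a + dtheta c a b = 0.
  (* The three derivatives of [lam] are orthogonal to [lam] by [lam_dl]. *)
  apply: (unit_contract (fun i => S i a b c)) => //.
  exact: nbhs_singleton lam1.
move=> a; apply/rowP => i; rewrite mxE.
apply: (skew_wedge_eq0 N2 T_skew T_unit (l := fun a => dl a 0 i)) => {}a b c.
by have := S i a b c; rewrite dth0 mulr0 add0r.
Unshelve. all: by end_near. Qed.

(** * Coordinate images of open sets *)

Lemma open_coord_image (R : realType) (m : nat) (T : topologicalType) (c : chart R m T)
    (O : set T) :
  open O -> open (coord c @` (dom c `&` O)).
Proof.
move=> oO; rewrite openE => _ [p [cp Op] <-].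
have cx : img c (coord c p) by exists p.
have nI : nbhs (coord c p) (img c) by apply: open_nbhs_nbhs; split => //; exact: img_open.
(* Continuity of [param c] sends coordinates near the given point into [O]. *)
have nO : nbhs (coord c p) (param c @^-1` O).
  by apply: (param_continuous cx); rewrite coordK//; exact: open_nbhs_nbhs.
rewrite /interior; near=> y.
have [q cq qy] : img c y by near: y.
by exists q => //; split=> //; rewrite -(coordK cq) qy; near: y.
Unshelve. all: by end_near. Qed.

(** * Skew forms defined by a metric and endomorphisms *)

Section MetricForms.
Context {R : realType} {m : nat}.

Lemma bilin_delta (G : 'M[R]_m) i j : bilin G (delta_mx i 0) (delta_mx j 0) = G i j.
Proof. by rewrite /bilin trmx_delta -rowE -colE !mxE. Qed.

Lemma definite_unitmx (G : 'M[R]_m) :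
  (forall u, u != 0 -> 0 < bilin G u u) -> G \in unitmx.
Proof.
move=> G_pos; rewrite -unitmx_tr -row_free_unit; apply: inj_row_free => v vG.
apply: trmx_inj; rewrite trmx0; apply/eqP/negPn/negP => /G_pos.
have Gv : G *m v^T = 0 by apply: trmx_inj; rewrite trmx_mul trmxK vG trmx0.
by rewrite /bilin -mulmxA Gv mulmx0 mxE ltxx.
Qed.

(** Orthogonality reads [A^T G A = G]; multiply on the right by [A] and use [A A = -1]. *)
Lemma orthogonal_complex_skew (G A : 'M[R]_m) :
  (forall u v, bilin G (A *m u) (A *m v) = bilin G u v) -> A *m A = - 1%:M ->
  A^T *m G = - (G *m A).
Proof.
move=> A_orth AA.
have E : A^T *m G *m A = G.
  apply/matrixP => i j; rewrite -!bilin_delta -A_orth.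
  by rewrite /bilin trmx_mul !mulmxA.
by rewrite -[in RHS]E -mulmxA AA mulmxN mulmx1 opprK.
Qed.

Lemma sum_skew (k : nat) (G : 'M[R]_m) (e : 'I_k -> 'M[R]_m) (a : 'I_k -> R) :
  (forall i, (e i)^T *m G = - (G *m e i)) ->
  (\sum_i a i *: e i)^T *m G = - (G *m \sum_i a i *: e i).
Proof.
move=> e_skew; rewrite linear_sum/= mulmx_suml mulmx_sumr -sumrN.
by apply: eq_bigr => i _; rewrite linearZ/= -scalemxAl e_skew -scalemxAr scalerN.
Qed.

Lemma bilin_trmul (G A : 'M[R]_m) u v : bilin (A^T *m G) u v = bilin G (A *m u) v.
Proof. by rewrite /bilin trmx_mul !mulmxA. Qed.

Lemma bilin_sum_comb (k : nat) (G : 'M[R]_m) (e : 'I_k -> 'M[R]_m) (a : 'I_k -> R) u v :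
  bilin ((\sum_i a i *: e i)^T *m G) u v = \sum_i a i * bilin ((e i)^T *m G) u v.
Proof.
rewrite /bilin linear_sum/= !mulmx_suml mulmx_sumr mulmx_suml summxE.
apply: eq_bigr => i _.
by rewrite linearZ/= -scalemxAl -scalemxAr -scalemxAl mxE.
Qed.

End MetricForms.

(** * Quaternionic relations and the Levi-Civita connection in one chart *)

Section HyperkahlerChart.
Context {R : realType} {n : nat} (M : hyperkahler R n) (c : chart R (4 * n) M).
Hypothesis ac : atlas c.
Local Notation G := (hk_metric M c).

Section Point.
Variable x : 'cV[R]_(4 * n).
Hypothesis cx : img c x.

Lemma hk_JJ1 : hk_J1 M c x *m hk_J1 M c x = - 1%:M.
Proof. exact: (@hk_J1_complex _ _ M). Qed.

Lemma hk_JJ2 : hk_J2 M c x *m hk_J2 M c x = - 1%:M.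
Proof. exact: (@hk_J2_complex _ _ M). Qed.

Lemma hk_J12 : hk_J1 M c x *m hk_J2 M c x = - (hk_J2 M c x *m hk_J1 M c x).
Proof. exact: (@hk_anticommute _ _ M). Qed.

(** Each of the nine cases is normalised by moving the first structure to the left of the second and
    cancelling squares. *)
Lemma hk_J_clifford i j :
  hk_J i c x *m hk_J j c x + hk_J j c x *m hk_J i c x = (- 2 * (i == j)%:R)%:M.
Proof.
have I1 := hk_JJ1; have I2 := hk_JJ2; have A := hk_J12.
rewrite /hk_J; move: (hk_J1 M c x) (hk_J2 M c x) I1 I2 A => I J I1 I2 A.
have C : J *m I = - (I *m J) by rewrite A opprK.
have I1' (X : 'M[R]_(4 * n)) : I *m (I *m X) = - X by rewrite mulmxA I1 mulNmx mul1mx.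
have I2' (X : 'M[R]_(4 * n)) : J *m (J *m X) = - X by rewrite mulmxA I2 mulNmx mul1mx.
have C' (X : 'M[R]_(4 * n)) : J *m (I *m X) = - (I *m (J *m X)).
  by rewrite mulmxA C mulNmx mulmxA.
have two : - 1%:M - 1%:M = (- 2)%:M :> 'M[R]_(4 * n).
  by rewrite -raddfN -raddfD/= (_ : - 1 - 1 = - 2 :> R)//; ring.
case: i => [[|[|[|//]]] ip]; case: j => [[|[|[|//]]] jp];
  rewrite /tnth/= ?mulr1 ?mulr0 ?raddf0 -?mulmxA;
  do 2!rewrite ?I1' ?I2' ?C' ?C ?I1 ?I2 ?mulmxN;
  by rewrite ?mulmx1 ?opprK ?two ?subrr ?addNr.
Qed.

Lemma hk_J_skew i : (hk_J i c x)^T *m G x = - (G x *m hk_J i c x).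
Proof.
have S1 := orthogonal_complex_skew (hk_J1_orthogonal ac cx) hk_JJ1.
have S2 := orthogonal_complex_skew (hk_J2_orthogonal ac cx) hk_JJ2.
have A := hk_J12.
rewrite /hk_J; case: i => [[|[|[|//]]] ip]; rewrite /tnth//=.
(* For the third structure, transposition reverses the two skew factors and anticommutation restores
   their order with a sign. *)
rewrite trmx_mul -[LHS]mulmxA S1 mulmxN [in LHS]mulmxA S2 A mulmxN mulNmx.
by rewrite mulmxA.
Qed.

(** Symmetry of the Gram matrix holds on the open set [img c], so it survives differentiation. *)
Lemma gram_derivative_sym k : (partial k G x)^T = partial k G x.
Proof.
have dG := smooth_on_is_derive k (gram_smooth (hk_metric M) ac) cx.
have dGT := is_derive_trmx dG.
rewrite -(@derive_val _ _ _ _ _ _ _ dGT); apply: near_eq_derive.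
near=> y; apply: gram_sym => //; near: y.
by apply: open_nbhs_nbhs; split => //; exact: img_open.
Unshelve. all: by end_near. Qed.

(** The matrix [Gamma(u)] in [nabla_u v = d_u v + Gamma(u) v]. *)
Definition connection_form (u : 'cV[R]_(4 * n)) : 'M[R]_(4 * n) :=
  \sum_k u k 0 *: christoffel G k x.

Lemma connection_form_sym u v : connection_form u *m v = connection_form v *m u.
Proof.
apply/matrixP => i j; rewrite ord1 {j} !mulmx_suml !summxE.
under eq_bigr do rewrite -scalemxAl !mxE mulr_sumr.
under [RHS]eq_bigr do rewrite -scalemxAl !mxE mulr_sumr.
rewrite exchange_big/=; apply: eq_bigr => j _; apply: eq_bigr => k _.
rewrite (christoffel_torsion_free gram_derivative_sym i j k).
by rewrite mulrCA [RHS]mulrCA [u k 0 * _]mulrC.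
Qed.

End Point.

Section Pullback.
Context {V : normedModType R} (F : V -> 'cV[R]_(4 * n)) (x e : V).
Hypotheses (dF : differentiable F x) (cFx : img c (F x)).
Local Notation C := (connection_form (F x) ('D_e F x)).

(** Metric compatibility, carried along [F] by the chain rule. *)
Lemma is_derive_gram_comp :
  is_derive x e (fun y => G (F y)) (C^T *m G (F x) + G (F x) *m C).
Proof.
have dG := smooth_on_differentiable (gram_smooth (hk_metric M) ac) cFx.
apply: is_derive_eq (is_derive_comp e dF dG) _.
rewrite derive_partial// linear_sum/= mulmx_suml mulmx_sumr -big_split/=.
apply: eq_bigr => k _.
rewrite linearZ/= -scalemxAl -scalemxAr -scalerDr; congr (_ *: _).
apply: christoffel_metric.
- by apply: definite_unitmx; apply: gram_pos.
- exact: gram_sym.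
- exact: gram_derivative_sym.
Qed.

(** Vanishing of the covariant derivative reads [d_k A = A Gamma_k - Gamma_k A]; the chain rule
    contracts this with the derivative of [F]. *)
Lemma is_derive_parallel_pullback (A : endo_field M) :
  parallel (hk_metric M) A ->
  is_derive x e (fun y => A c (F y)) (A c (F x) *m C - C *m A c (F x)).
Proof.
move=> pA; have dA := smooth_on_differentiable (endo_smooth A ac) cFx.
apply: is_derive_eq (is_derive_comp e dF dA) _.
rewrite derive_partial// mulmx_suml mulmx_sumr -sumrB.
apply: eq_bigr => k _; rewrite -scalemxAl -scalemxAr -scalerBr; congr (_ *: _).
have := pA c (F x) ac cFx k; rewrite /covariant_derivative.
by move/eqP; rewrite subr_eq0 => /eqP <-; rewrite addrK.
Qed.

Lemma is_derive_hk_J_comp i :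
  is_derive x e (fun y => hk_J i c (F y)) (hk_J i c (F x) *m C - C *m hk_J i c (F x)).
Proof.
have D1 := is_derive_parallel_pullback (@hk_J1_parallel _ _ M).
have D2 := is_derive_parallel_pullback (@hk_J2_parallel _ _ M).
rewrite /hk_J; case: i => [[|[|[|//]]] ip]; rewrite /tnth//=.
exact: is_derive_parallel_comp.
Qed.

End Pullback.

End HyperkahlerChart.

(** * Local constancy of the phase map in charts *)

Section PhaseInCharts.
Context {R : realType} {n : nat} {M : hyperkahler R n} {L : manifold R (2 * n)}.
Variables (f : L -> M) (J : L -> 'rV[R]_3) (c : chart R (2 * n) L) (c' : chart R (4 * n) M).
Hypotheses (n_gt1 : (1 < n)%N) (f_imm : immersion f) (J_smooth : smooth_function J).
Hypotheses (J_sphere : forall p, sphere2 (J p)).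
Hypotheses (J_phase : forall p, Omega_vanishes_at f (J p) p).
Hypotheses (ac : atlas c) (ac' : atlas c').

Let F := coord c' \o f \o param c.
Let lam := J \o param c.
Let U := coord c @` (dom c `&` f @^-1` dom c').

Lemma chart_overlap_open : open U.
Proof.
apply: open_coord_image; have [[f_cont _] _] := f_imm.
by apply: open_comp => [p _|]; [exact: f_cont|exact: dom_open].
Qed.

Lemma phase_constant_in_chart x : U x -> \forall y \near x, lam y = lam x.
Proof.
have [[_ f_smooth] f_inj] := f_imm.
have sF : smooth_on U F by exact: f_smooth.
have oU := chart_overlap_open.
have UP y : U y -> exists p,
    [/\ dom c p, dom c' (f p), coord c p = y, param c y = p & img c' (F y)].
  move=> [p [cp c'p] <-]; exists p; split => //; first exact: coordK.
  by exists (f p) => //; rewrite /F/= coordK.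
have sl : smooth_on (img c) lam by exact: J_smooth.
have cU y : U y -> img c y by move=> [p [cp _] <-]; exists p.
(* [W i] is the matrix of [omega_i] along [F], and [p i b d] are the components of its pullback to
   [L]. *)
pose W i y : 'M[R]_(4 * n) := (hk_J i c' (F y))^T *m hk_metric M c' (F y).
pose p i b d y := bilin (W i y) (partial b F y) (partial d F y).
have tangentE y : U y -> exists q, [/\ y = coord c q, F y = coord c' (f q), atlas_at q c,
    atlas_at (f q) c' & lam y = J q].
  by case/UP => q [cq c'q <- pq _]; exists q; rewrite /F/lam/= pq.
have vanish y mu : U y -> sphere2 mu -> dot3 (lam y) mu = 0 -> forall b d,
    bilin ((hk_comb mu c' (F y))^T *m hk_metric M c' (F y))
      (partial b F y) (partial d F y) = 0 /\
    bilin ((hk_comb mu c' (F y) *m hk_comb (lam y) c' (F y))^T *m hk_metric M c' (F y))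
      (partial b F y) (partial d F y) = 0.
  move=> Uy mu1 lmu b d; have dFy := smooth_on_differentiable sF Uy.
  have [q [yq Fq cq c'q lq]] := tangentE y Uy.
  rewrite lq in lmu *.
  have ran a : range (tangent_map f q c c') (partial a F y).
    by exists (delta_mx a 0) => //; rewrite /tangent_map -yq /partial deriveE.
  have := J_phase cq c'q mu1 lmu (ran b) (ran d).
  rewrite -Fq /Omega /omega => /eqP; rewrite eq_complex/= => /andP[/eqP E1 /eqP E2].
  by rewrite !bilin_trmul.
(* The real parts give [omega_K = 0] for [K] orthogonal to the phase, so the three pulled back forms
   are proportional to [lam]. *)
have pE y : U y -> forall i b d, p i b d y = lam y 0 i * \sum_j lam y 0 j * p j b d y.
  move=> Uy i b d; have [q [_ _ _ _ lq]] := tangentE y Uy.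
  apply: (@vanishing_on_orthogonal R R^o (fun i => p i b d y) (lam y)).
    by rewrite lq; exact: J_sphere.
  move=> mu mu1 lmu; have [+ _] := vanish y mu Uy mu1 lmu b d.
  by rewrite /hk_comb bilin_sum_comb.
have dlam0 y : U y -> forall a, partial a lam y = 0.
  move=> Uy.
  have nU : \forall z \near y, U z by exact: open_nbhs_nbhs.
  have dFy := smooth_on_differentiable sF Uy.
  have [q [cq c'q yq pq cFy]] := UP y Uy.
  (* The Jacobian matrix of [F]: its columns span the tangent space of [L], and [T] below is the
     matrix of [theta] on them. *)
  pose D : 'M[R]_(4 * n, 2 * n) := \matrix_(i, a) partial a F y i 0.
  have DE (v : 'cV[R]_(2 * n)) : D *m v = 'd F y v.
    rewrite -deriveE// derive_partial//; apply/matrixP => i j; rewrite ord1 summxE mxE.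
    by apply: eq_bigr => a _; rewrite !mxE mulrC.
  have D_col a : D *m delta_mx a 0 = partial a F y by rewrite DE -deriveE.
  have D_inj (v : 'cV[R]_(2 * n)) : D *m v = 0 -> v = 0.
    have := f_inj q c c' (conj ac cq) (conj ac' c'q); rewrite /tangent_map yq => inj.
    by rewrite DE => Dv; apply: inj; rewrite Dv linear0.
  have form_mx (B : 'M[R]_(4 * n)) b d :
      (D^T *m B *m D) b d = bilin B (partial b F y) (partial d F y).
    by rewrite -bilin_delta -!D_col /bilin trmx_mul !mulmxA.
  set T := \matrix_(b, d) \sum_j lam y 0 j * p j b d y.
  have TE : T = D^T *m ((hk_comb (lam y) c' (F y))^T *m hk_metric M c' (F y)) *m D.
    by apply/matrixP => b d; rewrite form_mx mxE /hk_comb bilin_sum_comb.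
  have lam1 : sphere2 (lam y) by rewrite /lam/= pq; exact: J_sphere.
  have G_pos := @gram_pos _ _ _ (hk_metric M) _ _ ac' cFy.
  have G_sym := @gram_sym _ _ _ (hk_metric M) _ _ ac' cFy.
  have comb_skew mu : (hk_comb mu c' (F y))^T *m hk_metric M c' (F y) =
      - (hk_metric M c' (F y) *m hk_comb mu c' (F y)).
    by apply: sum_skew => i; exact: hk_J_skew.
  have comb_anti a b : hk_comb a c' (F y) *m hk_comb b c' (F y) +
      hk_comb b c' (F y) *m hk_comb a c' (F y) = (- 2 * dot3 a b)%:M.
    by apply: clifford_comb => i j; exact: hk_J_clifford.
  have comb_sq a : sphere2 a -> hk_comb a c' (F y) *m hk_comb a c' (F y) = - 1%:M.
    move=> a1; have := comb_anti a a; rewrite [dot3 a a]a1 mulr1 => E.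
    apply: (@scalerI _ _ (2 : R)); first by rewrite pnatr_eq0.
    by rewrite scaler_nat mulr2n E scalerN scale_scalar_mx mulr1 -raddfN.
  have skewW B : B^T *m hk_metric M c' (F y) = - (hk_metric M c' (F y) *m B) ->
      (B^T *m hk_metric M c' (F y))^T = - (B^T *m hk_metric M c' (F y)).
    by move=> BS; rewrite trmx_mul trmxK G_sym BS opprK.
  have T_skew : T^T = - T.
    by rewrite TE trmx_mul [(D^T *m _)^T]trmx_mul trmxK skewW// mulNmx mulmxN mulmxA.
  (* A unit [mu] orthogonal to the phase gives a [K] anticommuting with [Jhat]; here both the real
     and the imaginary part of [Omega] are used. *)
  have T_unit : T \in unitmx.
    have [mu mu1 lmu] := exists_orthogonal_unit (lam y).
    have KJ := comb_anti mu (lam y); rewrite dot3C lmu mulr0 raddf0 in KJ.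
    rewrite -unitmx_tr -row_free_unit; apply: inj_row_free => v vT.
    apply: trmx_inj; rewrite trmx0.
    apply: (@lagrangian_nondegenerate _ _ _ _ (hk_comb mu c' (F y)) D G_pos D_inj
      (comb_skew (lam y)) (comb_skew mu) (comb_sq _ lam1) (comb_sq _ mu1)).
    - by apply/eqP; rewrite -addr_eq0 addrC KJ.
    - by apply/matrixP => b d; rewrite form_mx mxE; have [] := vanish y mu Uy mu1 lmu b d.
    - by apply/matrixP => b d; rewrite form_mx mxE; have [] := vanish y mu Uy mu1 lmu b d.
    - by rewrite -TE; apply: trmx_inj; rewrite trmx_mul trmxK vT trmx0.
  apply: (phase_derivative_eq0 _ _ _ _ _ T_skew T_unit).
  (* The assumption [n > 1] enters here, as [2 < 2n]. *)
  - by rewrite -[2%N]muln1 ltn_pmul2l.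
  - apply: filterS nU => z /UP[r [_ _ _ pr _]].
    by rewrite /lam/= pr; exact: J_sphere.
  - by apply: filterS nU => z; exact: pE.
  - by move=> a; case: (smooth_on_is_derive a sl (cU y Uy)).
  - move=> i.
    (* Closedness of the [i]-th form: second partials of [F] commute, the connection is
       torsion-free, and [W i] is parallel and skew. *)
    apply: (@pullback_closed R _ _ _ (fun a => delta_mx a 0) (fun a => partial a F)
       (fun a b => partial a (partial b F) y) (W i) (connection_form c' (F y)) y).
    + by move=> a b; apply: (smooth_on_is_derive a (smooth_on_partial b sF) Uy).
    + by move=> a b; exact: (partial_commute a b oU sF Uy).
    + by move=> u v; exact: connection_form_sym.
    + move=> a; apply: is_derive_metric_form.
        exact: is_derive_gram_comp.
      exact: is_derive_hk_J_comp.
    + by apply: skewW; exact: hk_J_skew.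
move=> Ux.
have nU : \forall z \near x, U z by exact: open_nbhs_nbhs.
(* The mean value argument concerns real functions, so the three components are treated
   separately. *)
have cst_i i : \forall y \near x, lam y 0 i = lam x 0 i.
  apply: locally_constant; apply: filterS nU => y Uy v.
  have dl := smooth_on_differentiable sl (cU y Uy).
  have -> : (0 : R) = (0 : 'rV[R]_3) 0 i by rewrite mxE.
  apply: is_derive_entry; apply: DeriveDef; first exact: diff_derivable.
  by rewrite derive_partial// big1// => a _; rewrite dlam0// scaler0.
have : \forall y \near x, forall i, lam y 0 i = lam x 0 i.
  exact: (@filter_forall _ _ (fun i y => lam y 0 i = lam x 0 i) (nbhs x) _ cst_i).
by apply: filterS => y ly; apply/rowP => i; exact: ly.
Qed.

End PhaseInCharts.

(** * From charts to the whole connected manifold *)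

Lemma locally_constant_connected (T : topologicalType) (S : Type) (J : T -> S) :
  connected [set: T] -> (forall p, \forall q \near p, J q = J p) ->
  forall p q, J q = J p.
Proof.
move=> T_conn J_lc p q.
suff /seteqP[_ /(_ q I)] : [set r | J r = J p] = [set: T] by [].
(* The level set through [p] is open by local constancy, and so is its complement. *)
apply: T_conn; first by exists p.
- exists [set r | J r = J p]; last by rewrite setTI.
  by rewrite openE => r <-; exact: J_lc.
- exists [set r | J r = J p]; last by rewrite setTI.
  rewrite -[X in closed X]setCK; apply: open_closedC.
  rewrite openE => r rp; apply: filterS (J_lc r) => s sr.
  by move=> sp; apply: rp; rewrite /= -sr.
Qed.

Theorem theorem1p1 (R : realType) (n : nat) (M : hyperkahler R n)
    (L : manifold R (2 * n)) (f : L -> M) :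
  (1 < n)%N -> immersion f -> hyper_lagrangian f -> complex_lagrangian f.
Proof.
move=> n_gt1 f_imm [J [J_smooth J_sphere J_phase]].
(* If [L] is empty, any unit vector serves. *)
have [[p0 _]|L0] := pselect (exists p : L, True); last first.
  have [lam lam1 _] := @exists_orthogonal_unit R 0.
  by exists lam => // p; case: L0; exists p.
exists (J p0) => // p.
rewrite (@locally_constant_connected _ _ J (@space_connected _ _ L) _ p p0)// => {}p.
have [c ac cp] := atlas_cover p.
have [c' ac' c'p] := atlas_cover (f p).
have cst_c : \forall y \near coord c p, J (param c y) = J (param c (coord c p)).
  by apply: (phase_constant_in_chart n_gt1 f_imm J_smooth J_sphere J_phase ac ac'); exists p.
(* Continuity of [coord c] transports local constancy from coordinates to [L]. *)
have near_p := coord_continuous cp cst_c.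
have near_dom : \forall q \near p, dom c q.
  by apply: open_nbhs_nbhs; split => //; exact: dom_open.
near=> q.
have cq : dom c q by near: q.
have : J (param c (coord c q)) = J (param c (coord c p)) by near: q.
by rewrite !coordK.
Unshelve. all: by end_near. Qed.
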